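(* Let $n,m\ge 1$ be integers and let $a\in\{0,1\}^{m+1}$ be any keyword. Then the number of equivalence classes of $\{0,1\}^n$ under the equivalence relation $\sim_a$ is equal to $F_0^{(m)}+F_1^{(m)}+\cdots+F_n^{(m)}$.
   Context: For a positive integer $m$, the $m$-step Fibonacci numbers $(F_n^{(m)})_{n\ge 0}$ are defined by $F_0^{(m)}=1$, $F_n^{(m)}=2^{n-1}$ for $n\in\{1,\dots,m-1\}$, and $F_n^{(m)}=F_{n-1}^{(m)}+\cdots+F_{n-m}^{(m)}$ for $n\ge m$. A binary word of length $n$ is an element $u=(u_1,\dots,u_n)\in\{0,1\}^n$; its negation $\neg u$ is obtained by replacing every $0$ by $1$ and every $1$ by $0$. For $u\in\{0,1\}^n$ and $1\le i\le j\le n$ write $u_{[i,j]}=(u_i,\dots,u_j)$. Fix a keyword $a\in\{0,1\}^{m+1}$. For $i\in\{1,\dots,n\}$, the simple map $\varphi_i^{(a)}:\{0,1\}^n\to\{0,1\}^n$ is defined as follows: if $i+m\le n$ and $u_{[i,i+m]}\in\{a,\neg a\}$, then $\varphi_i^{(a)}(u)$ is obtained from $u$ by negating exactly the letters in positions $i,\dots,i+m$; otherwise $\varphi_i^{(a)}(u)=u$. Write $u\sim_a v$ if there is a finite (possibly empty) sequence of indices $i_1,\dots,i_r$ with $(\varphi_{i_r}^{(a)}\circ\cdots\circ\varphi_{i_1}^{(a)})(u)=v$; this is an equivalence relation on $\{0,1\}^n$ (informally: an occurrence of $a$ as a contiguous subword may be replaced by $\neg a$ and vice versa, repeatedly). 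*)

(* Defs.v *)
From mathcomp Require Import all_boot.
Set Implicit Arguments. Unset Strict Implicit. Unset Printing Implicit Defensive.

(* [mfibs m n] is F_n, ..., F_1, F_0, latest term first; the clauses of the
   usual definition of the m-step Fibonacci numbers are [mfib0], [mfib_small]
   and [mfib_rec] below. *)
Fixpoint mfibs (m n : nat) : seq nat :=
  if n is n'.+1 then
    (if n < m then 2 ^ n' else sumn (take m (mfibs m n'))) :: mfibs m n'
  else [:: 1].

Definition mfib (m n : nat) : nat := head 0 (mfibs m n).

Definition negw (k : nat) (u : k.-tuple bool) : k.-tuple bool := map_tuple negb u.

(* Positions are numbered from 0: i : 'I_n stands for the letter u_(i+1), and
   [take m.+1 (drop i u)] is the factor u_[i+1, i+1+m] whenever it fits. *)
Definition simple_map (n m : nat) (a : m.+1.-tuple bool) (i : 'I_n)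
    (u : n.-tuple bool) : n.-tuple bool :=
  if (i + m < n) && (take m.+1 (drop i u) \in [:: val a; val (negw a)]) then
    [tuple (if i <= j <= i + m then ~~ tnth u j else tnth u j) | j < n]
  else u.

Definition step (n m : nat) (a : m.+1.-tuple bool) : rel (n.-tuple bool) :=
  fun u v => [exists i : 'I_n, simple_map a i u == v].

(* The decidable form of "v is reached from u by finitely many simple maps",
   see [simP]. *)
Definition sim (n m : nat) (a : m.+1.-tuple bool) : rel (n.-tuple bool) :=
  connect (step a).

Lemma mfib0 m : mfib m 0 = 1.
Proof. by []. Qed.

Lemma mfib_small m n : 0 < n < m -> mfib m n = 2 ^ n.-1.
Proof. by case: n => //= n nm; rewrite /mfib /= nm. Qed.

Lemma mfibsE m n : mfibs m n = [seq mfib m (n - k) | k <- iota 0 n.+1].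
Proof.
elim: n => [//|n IH].
rewrite [LHS]/= {2}IH -[iota 0 n.+2]/(0 :: iota 1 n.+1) map_cons subn0.
by rewrite (iotaDl 1 0) -map_comp; congr cons; apply: eq_map => k /=; rewrite subSS.
Qed.

Lemma mfib_rec m n : 0 < m <= n ->
  mfib m n = \sum_(1 <= k < m.+1) mfib m (n - k).
Proof.
case: n => [|n] /andP[m0 mn]; first by rewrite leqNgt m0 in mn.
rewrite {1}/mfib /= ltnNge mn /= mfibsE -map_take take_iota.
rewrite (minn_idPl mn) sumnE big_map big_add1 /= /index_iota subn0.
by apply: eq_bigr => k _; rewrite subSS.
Qed.

Lemma simP (n m : nat) (a : m.+1.-tuple bool) (u v : n.-tuple bool) :
  reflect (exists s : seq 'I_n, foldl (fun w i => simple_map a i w) u s = v)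
          (sim a u v).
Proof.
apply: (iffP connectP) => [[p]|[s <-]].
  elim: p u => [|w p IH] u /=; first by move=> _ ->; exists [::].
  case/andP=> /existsP[i /eqP <-] pp lp.
  by have [s <-] := IH _ pp lp; exists (i :: s).
elim: s u => [|i s IH] u /=; first by exists [::].
have [p pp ->] := IH (simple_map a i u).
exists (simple_map a i u :: p) => //=; rewrite pp andbT.
by apply/existsP; exists i.
Qed.

Lemma tnth_simple_map (n m : nat) (a : m.+1.-tuple bool) (i : 'I_n)
    (u : n.-tuple bool) (j : 'I_n) :
  (i + m < n) && (take m.+1 (drop i u) \in [:: val a; val (negw a)]) ->
  tnth (simple_map a i u) j = (i <= j <= i + m) (+) tnth u j.
Proof. by rewrite /simple_map => ->; rewrite tnth_mktuple; case: ifP. Qed.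

Lemma simple_map_invol (n m : nat) (a : m.+1.-tuple bool) (i : 'I_n) :
  involutive (@simple_map n m a i).
Proof.
move=> u; case c : ((i + m < n) && (take m.+1 (drop i u) \in [:: val a; val (negw a)])); last first.
  by have e : simple_map a i u = u; [rewrite /simple_map c | rewrite !e].
have [/= im win] := andP c.
have wE : take m.+1 (drop i (simple_map a i u)) = map negb (take m.+1 (drop i u)).
  apply: (@eq_from_nth _ false) => [|k].
    by rewrite size_map !size_take !size_drop !size_tuple.
  rewrite size_take size_drop size_tuple => kl.
  have km : k < m.+1 by move: kl; case: ifP => // /negbT; rewrite -leqNgt => h /leq_trans; apply.
  have kn : i + k < n by apply: leq_ltn_trans im; rewrite leq_add2l.
  rewrite (nth_map false); last by rewrite size_take size_drop size_tuple.
  rewrite !nth_take // !nth_drop.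
  rewrite -(tnth_nth false (simple_map a i u) (Ordinal kn)).
  rewrite -(tnth_nth false u (Ordinal kn)) tnth_simple_map //=.
  by rewrite leq_addr leq_add2l -ltnS km.
apply: eq_from_tnth => j; rewrite !tnth_simple_map ?addbA ?addbb //.
rewrite im wE /=; move: win; rewrite !inE => /orP[]/eqP ->; rewrite ?eqxx ?orbT //.
by rewrite -map_comp (eq_map (g := id)) ?map_id ?eqxx // => x /=; rewrite negbK.
Qed.

Lemma sim_equiv (n m : nat) (a : m.+1.-tuple bool) :
  equivalence_rel (@sim n m a).
Proof.
have sym : connect_sym (@step n m a).
  apply: sym_connect_sym => u v.
  by apply/existsP/existsP => -[i /eqP <-]; exists i; rewrite simple_map_invol.
split=> [|uv]; first exact: connect0.
exact: (same_connect sym uv).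
Qed.

(* Main.v *)
(** Let C n be the number of classes of words of length n, and let A n be the
    number of words of length n avoiding y x^m. A word b :: u with u avoiding
    fails to avoid iff it starts with y x^m, so A (n+1) + A (n-m) = 2 A n (without
    the second summand if n < m), which F_0 + ... + F_n satisfies too.

    C n <= A n: C n is the dimension of the space of rational functions on words
    which are constant on classes. Written in the basis x = e_0 + e_1,
    y = e_0 - e_1 of the letters, invariance at one place is a single linear
    relation, with nonzero coefficients, between all the words of length m+1 having
    an odd number of y's. Solving it for y x^m shows that such a function is
    determined by its coefficients at the avoiding words, whatever the keyword.

    C (n+1) >= 2 C n - C (n-m): among the pairs (first letter, class of the rest),
    the only identifications left to make are those of a q with its partner
    (neg a) q, and it suffices to take one q from each class of length n-m.
    Induction then gives C n = A n. *)
Require Import Defs.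
From mathcomp Require Import all_boot.
From mathcomp Require Import all_algebra zify ring.

Set Implicit Arguments.
Unset Strict Implicit.
Unset Printing Implicit Defensive.

Import GRing.Theory Num.Theory.

(** * Cardinality bounds from ranks of rational matrices *)

Section RankBounds.
Local Open Scope ring_scope.

(** The hypothesis says that the rows of [M], restricted to the columns in [L], are linearly
    independent, so the rank is [#|A|]. *)
Lemma card_le_separating (A : finType) (W : Type) (w0 : W) (L : seq W)
    (M : A -> W -> rat) :
  (forall f : A -> rat,
     (forall i, (i < size L)%N -> \sum_c f c * M c (nth w0 L i) = 0) ->
     forall c, f c = 0) ->
  (#|A| <= size L)%N.
Proof.
move=> inj.
pose X := \matrix_(i < #|A|, j < size L) M (enum_val i) (nth w0 L j).
suff /eqP <- : row_free X by exact: rank_leq_col.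
suff k0 : kermx X = 0 by rewrite -kermx_eq0 k0.
apply/row_matrixP => i; rewrite row0.
set v := row i _.
have vX : v *m X = 0 by apply/sub_kermxP; exact: row_sub.
have := inj (fun c => v ord0 (enum_rank c)) _.
move=> h; apply/rowP => j; rewrite [RHS]mxE.
rewrite -[j]enum_valK; apply: h => k kL.
have := congr1 (fun N : 'rV_ _ => N ord0 (Ordinal kL)) vX.
rewrite [LHS]mxE [RHS]mxE => vXk; rewrite -[RHS]vXk.
rewrite [LHS](reindex_onto (@enum_val A A) enum_rank) /=; last by move=> c _; rewrite enum_rankK.
apply: eq_big => [c|c _]; first by rewrite enum_valK eqxx.
by rewrite enum_valK [X in _ = _ * X]mxE.
Qed.

(** Functions constant along the edges [E] form a kernel of dimension at least [#|A| - size E]. They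
    all factor through [h], hence lie in a space spanned by [#|B|] fibre indicators. *)
Lemma card_le_collapse (A B : finType) (h : A -> B) (E : seq (A * A)) :
  (forall f : A -> rat, (forall e, e \in E -> f e.1 = f e.2) ->
     forall x y, h x = h y -> f x = f y) ->
  (#|A| <= #|B| + size E)%N.
Proof.
move=> fac.
case: (pickP A) => [x0 _|A0]; last by rewrite (eq_card0 A0).
pose X := \matrix_(i < #|A|, j < size E)
   (((enum_val i == (nth (x0, x0) E j).1)%:R
     - (enum_val i == (nth (x0, x0) E j).2)%:R) : rat).
pose P := \matrix_(b < #|B|, i < #|A|) ((h (enum_val i) == enum_val b)%:R : rat).
have sub : (kermx X <= P)%MS.
  apply/row_subP => i; set v := row i _.
  have vX : v *m X = 0 by apply/sub_kermxP; exact: row_sub.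
  have hv := fac (fun x => v ord0 (enum_rank x)) _.
  have {}hv x y : h x = h y -> v ord0 (enum_rank x) = v ord0 (enum_rank y).
    apply: hv => e eE.
    have ie : (index e E < size E)%N by rewrite index_mem.
    have := congr1 (fun N : 'rV_ _ => N ord0 (Ordinal ie)) vX.
    rewrite [LHS]mxE [RHS]mxE.
    under eq_bigr => j _ do rewrite [X _ _]mxE /= nth_index // mulrBr.
    have sel x1 : \sum_j v ord0 j * (enum_val j == x1)%:R = v ord0 (enum_rank x1).
      rewrite (bigD1 (enum_rank x1)) //= enum_rankK eqxx mulr1 big1 ?addr0 // => j.
      by rewrite (can2_eq (@enum_valK _) (@enum_rankK _)) => /negbTE ->; rewrite mulr0.
    by rewrite big_split /= sumrN !sel => /eqP; rewrite subr_eq0 => /eqP.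
  (* The factorisation of [v] through [h], extended by 0 outside the image of [h]. *)
  pose g b := if [pick x | h x == b] is Some x then v ord0 (enum_rank x) else 0.
  apply/submxP; exists (\row_b g (enum_val b)).
  apply/rowP => j; rewrite [RHS]mxE.
  rewrite (bigD1 (enum_rank (h (enum_val j)))) //= [P _ _]mxE enum_rankK eqxx mulr1.
  rewrite [X in X + _]mxE enum_rankK.
  rewrite big1 ?addr0 => [|b bj]; last first.
    rewrite [P _ _]mxE eq_sym (can2_eq (@enum_valK _) (@enum_rankK _)).
    by rewrite (negbTE bj) mulr0.
  rewrite /g; case: pickP => [x /eqP hx|/(_ (enum_val j))]; last by rewrite eqxx.
  by rewrite (hv _ _ hx) enum_valK.
have := leq_trans (mxrankS sub) (rank_leq_row P).
rewrite mxrank_ker; have := rank_leq_col X; lia.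
Qed.

End RankBounds.

(* The transform in the basis x = e_0 + e_1, y = e_0 - e_1 of the letters;
   in an index word, [false] stands for x and [true] for y. *)
Section Transform.
Local Open Scope ring_scope.

Fixpoint hat (F : seq bool -> rat) (w : seq bool) : rat :=
  if w is b :: w' then
    hat (fun u => F (false :: u)) w' + (-1) ^+ b * hat (fun u => F (true :: u)) w'
  else F [::].

Lemma eq_hat F G w : (forall u, size u = size w -> F u = G u) -> hat F w = hat G w.
Proof.
elim: w F G => [|b w IH] F G FG /=; first exact: FG.
by congr (_ + _ * _); apply: IH => u uw; apply: FG; rewrite /= uw.
Qed.

Lemma hat0 w : hat (fun=> 0) w = 0.
Proof. by elim: w => //= b w ->; rewrite mulr0 addr0. Qed.

Lemma hatD F G w : hat (fun u => F u + G u) w = hat F w + hat G w.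
Proof. by elim: w F G => //= b w IH F G; rewrite !IH; ring. Qed.

Lemma hatZ c F w : hat (fun u => c * F u) w = c * hat F w.
Proof. by elim: w F => //= b w IH F; rewrite !IH; ring. Qed.

Lemma hat_sum (I : Type) (r : seq I) (F : I -> seq bool -> rat) w :
  hat (fun u => \sum_(i <- r) F i u) w = \sum_(i <- r) hat (F i) w.
Proof.
elim: r => [|i r IH].
  by rewrite big_nil -[RHS](hat0 w); apply: eq_hat => u _; rewrite big_nil.
by rewrite big_cons -IH -hatD; apply: eq_hat => u _; rewrite big_cons.
Qed.

Lemma hat_cat F p w : hat F (p ++ w) = hat (fun v => hat (fun u => F (v ++ u)) w) p.
Proof. by elim: p F => //= b p IH F; rewrite !IH. Qed.

Lemma hat_exchange (K : seq bool -> seq bool -> rat) p w :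
  hat (fun v => hat (K v) p) w = hat (fun u => hat (K^~ u) w) p.
Proof.
elim: p K => //= b p IH K; rewrite hatD hatZ.
by rewrite (IH (fun v u => K v (false :: u))) (IH (fun v u => K v (true :: u))).
Qed.

(** The one-letter matrix with rows (1, 1) and (1, -1) squares to twice the identity. *)
Lemma hat_hat F w : hat (hat F) w = 2 ^+ size w * F w.
Proof.
elim: w F => [|b w IH] F /=; first by rewrite expr0 mul1r.
rewrite !hatD !hatZ !IH [in RHS]exprS.
by case: b; rewrite /= ?expr0 ?expr1; ring.
Qed.

Lemma hat_inj0 F n : (forall w, size w = n -> hat F w = 0) ->
  forall w, size w = n -> F w = 0.
Proof.
move=> F0 w wn; have := hat_hat F w.
rewrite (eq_hat (G := fun=> 0)) => [|u uw]; last by apply: F0; rewrite uw.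
by move/esym/eqP; rewrite hat0 mulf_eq0 expf_eq0 pnatr_eq0 andbF => /eqP.
Qed.

Lemma hat_negb F w :
  hat F (map negb w) = hat (fun u => (-1) ^+ count id u * F u) w.
Proof.
elim: w F => [|b w IH] F /=; first by rewrite mul1r.
rewrite !IH; congr (_ + _).
rewrite (eq_hat (F := fun u => (-1) ^+ (true + count id u) * F (true :: u))
  (G := fun u => -1 * ((-1) ^+ count id u * F (true :: u)))) ?hatZ.
  by case: b; rewrite ?expr0 ?expr1; ring.
by move=> u _; rewrite exprD expr1; ring.
Qed.

(** When only [w0] contributes, [hat F w] is [F w0] up to sign. *)
Lemma hat_supp1 F w0 w : size w0 = size w ->
  (forall u, size u = size w -> u <> w0 -> F u = 0) ->
  hat F w = 0 -> F w0 = 0.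
Proof.
elim: w w0 F => [|b w IH] [|c w0] F //= [sw0] F0.
pose H d := hat (fun u => F (d :: u)) w.
have other d : d != c -> H d = 0.
  move=> dc; rewrite -[RHS](hat0 w); apply: eq_hat => u uw.
  by apply: F0 => /=; [rewrite uw | move=> [e]; rewrite e eqxx in dc].
have this : H c = 0 -> F (c :: w0) = 0.
  apply: (IH w0 (fun u => F (c :: u))) => // u uw uw0.
  by apply: F0 => /=; [rewrite uw | move=> [] /uw0].
rewrite -/(H false) -/(H true).
case: c other this {F0} => other this.
  rewrite (other false) // add0r => /eqP; rewrite mulf_eq0 signr_eq0 => /eqP; exact: this.
rewrite (other true) // mulr0 addr0; exact: this.
Qed.

(* Negating every letter fixes x and changes the sign of y, so the condition
   F a = F (neg a) only involves words with an odd number of y's. *)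
Lemma hat_odd_last F a w0 : size w0 = size a -> odd (count id w0) ->
  F a = F (map negb a) ->
  (forall w, size w = size a -> odd (count id w) -> w <> w0 -> hat F w = 0) ->
  hat F w0 = 0.
Proof.
move=> sw0 ow0 Fa F0.
have : 2 * hat F w0 = 0.
  (* [K] is [2 * hat F] on odd words and 0 on even ones; its transform at [a] is a multiple of
     [F a - F (map negb a)], hence 0. *)
  pose K w := (1 - (-1) ^+ count id w) * hat F w.
  have -> : 2 * hat F w0 = K w0 by rewrite /K -signr_odd ow0 expr1; ring.
  apply: (@hat_supp1 K w0 a) => // [w wa ww0|].
    rewrite /K -signr_odd; case: (boolP (odd _)) => ow; last by rewrite subrr mul0r.
    by rewrite F0 ?mulr0.
  have := hat_negb (hat F) a; rewrite !hat_hat size_map -Fa -hat_hat.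
  rewrite (eq_hat (F := K) (G := fun w => hat F w
     + -1 * ((-1) ^+ count id w * hat F w))) => [|u _]; last by rewrite /K; ring.
  by rewrite hatD hatZ => <-; ring.
by move/eqP; rewrite mulf_eq0 pnatr_eq0 => /eqP.
Qed.

End Transform.

(** * Counting the words that avoid y x^m *)

Section Avoiders.
Variable m : nat.

Fixpoint avoids (w : seq bool) : bool :=
  if w is b :: w' then
    avoids w' && ~~ (b && prefix (nseq m false) w') else true.

Lemma avoidsPn w :
  ~~ avoids w -> exists p q, w = p ++ (true :: nseq m false) ++ q.
Proof.
elim: w => //= b w IH; rewrite negb_and negbK => /orP[/IH[p [q ->]]|].
  by exists (b :: p), q.
by case/andP => -> /prefixP[q ->]; exists [::], q.
Qed.

Fixpoint words (n : nat) : seq (seq bool) :=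
  if n is n'.+1 then map (cons false) (words n') ++ map (cons true) (words n')
  else [:: [::]].

Lemma mem_words w : w \in words (size w).
Proof.
elim: w => //= b w IH; rewrite mem_cat.
by case: b; rewrite (map_f (cons _) IH) ?orbT.
Qed.

Lemma size_in_words n w : w \in words n -> size w = n.
Proof.
elim: n w => [|n IH] w /=; first by rewrite inE => /eqP ->.
by rewrite mem_cat => /orP[]/mapP[u /IH <- ->].
Qed.

Definition avoiders n := filter avoids (words n).

(** The forbidden factor begins with y, so putting x's in front of a word never creates an
    occurrence. *)
Lemma count_prefix_false k n :
  count (predI avoids (prefix (nseq k false))) (words (k + n)) = count avoids (words n).
Proof.
elim: k => [|k IH].
  by apply: eq_count => w /=; rewrite prefix0s andbT.
rewrite addSn /= count_cat !count_map -IH -[RHS]addn0; congr (_ + _).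
  by apply: eq_count => w /=; rewrite andbT.
by rewrite -(@count_pred0 _ (words (k + n))); apply: eq_count => w /=; rewrite andbF.
Qed.

Lemma size_avoidersS n :
  size (avoiders n.+1) + (if m <= n then size (avoiders (n - m)) else 0)
  = 2 * size (avoiders n).
Proof.
have -> : (if m <= n then size (avoiders (n - m)) else 0)
    = count (predI avoids (prefix (nseq m false))) (words n).
  case: leqP => mn.
    by rewrite size_filter -(count_prefix_false m) subnKC.
  rewrite -(@count_pred0 _ (words n)); apply: eq_in_count => w /size_in_words wn /=.
  apply/esym/negbTE/negP => /andP[_ /size_prefix].
  by rewrite size_nseq wn leqNgt mn.
rewrite !size_filter /= count_cat !count_map mul2n -addnn -addnA; congr (_ + _).
  by apply: eq_count => w /=; rewrite andbT.
rewrite -[RHS]size_filter -[RHS](count_predC (prefix (nseq m false))) !count_filter.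
by rewrite addnC; congr (_ + _); apply: eq_count => w /=; rewrite andbC.
Qed.

End Avoiders.

Lemma sum_reverse_window (F : nat -> nat) m n : m <= n ->
  \sum_(1 <= k < m.+1) F (n - k) = \sum_(n - m <= j < n) F j.
Proof.
elim: m => [|m IH] mn; first by rewrite subn0 !big_geq.
rewrite big_nat_recr //= IH ?(ltnW mn) // [RHS]big_ltn; last by lia.
by rewrite addnC subnSK.
Qed.

Lemma size_avoiders m n : 0 < m ->
  size (avoiders m n) = \sum_(0 <= k < n.+1) mfib m k.
Proof.
move=> m0; pose S n := \sum_(0 <= k < n.+1) mfib m k.
have SS k : S k.+1 = S k + mfib m k.+1 by rewrite /S big_nat_recr.
have Ssmall k : k < m -> S k = 2 ^ k.
  elim: k => [|k IH] km; first by rewrite /S big_nat1.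
  by rewrite SS IH ?(ltnW km) // mfib_small //= expnS mul2n addnn.
(* The m terms summing to F_(k+1) are the last ones of [S k], and [S (k - m)] is what remains. For k
   + 1 = m they reach down to F_0 and nothing remains. *)
have SE k : mfib m k.+1 + (if m <= k then S (k - m) else 0) = S k.
  have [km|mk] := ltnP k.+1 m.
    by rewrite leqNgt ltnW //= addn0 mfib_small // Ssmall // ltnW.
  have -> : mfib m k.+1 = \sum_(k.+1 - m <= j < k.+1) mfib m j.
    by rewrite mfib_rec ?m0 // sum_reverse_window.
  rewrite /S addnC; case: leqP => mk'.
    by rewrite [RHS](big_cat_nat _ (n := k.+1 - m)) ?subSn ?leq_subr //; lia.
  by have -> : k.+1 - m = 0 by lia.
elim/ltn_ind: n => -[|n] IH; first by rewrite big_nat1.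
have := size_avoidersS m n; have := SE n; rewrite -/(S n.+1) SS (IH n) // -/(S n).
case: leqP => mn; last by lia.
by rewrite (IH (n - m)) -/(S (n - m)); lia.
Qed.

(** The first letter is the least significant digit, so that y x^m has value 1. *)
Fixpoint binval (w : seq bool) : nat := if w is b :: w' then b + 2 * binval w' else 0.

Lemma binval_cat p w : binval (p ++ w) = binval p + 2 ^ size p * binval w.
Proof. by elim: p => [|b p IH] /=; rewrite ?mul1n // IH expnS; lia. Qed.

Lemma binval_lt w : binval w < 2 ^ size w.
Proof. by elim: w => //= b w IH; rewrite expnS; case: b; lia. Qed.

Lemma binval_eq0 w : binval w = 0 -> w = nseq (size w) false.
Proof. by elim: w => //= -[] w IH //= w0; congr cons; apply: IH; lia. Qed.

(** An odd number of y's excludes the value 0, and y x^m is the only word of its length with value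
    1. *)
Lemma binval_gt1 w m : size w = m.+1 -> odd (count id w) ->
  w <> true :: nseq m false -> 1 < binval w.
Proof.
case: w => // b w [<-] /= ow ww.
have [|] := posnP (binval w); last by case: b {ow ww}; lia.
move=> /binval_eq0 we; exfalso; move: ow ww; rewrite we size_nseq.
by rewrite count_nseq mul0n addn0; case: b.
Qed.

(** * Equivalence classes of words and their number *)

Section Classes.
Variables (m : nat) (a : m.+1.-tuple bool).

Lemma step_connect_sym n : connect_sym (@step n m a).
Proof.
have sub u v : sim a u v -> sim a v u.
  by move=> uv; rewrite -((sim_equiv a u v u).2 uv) /sim connect0.
by move=> u v; apply/idP/idP; exact: sub.
Qed.

(** Stated on plain sequences, so that prefixes and suffixes can be split off without casts between
    tuple types. *)
Definition invariant n (X : Type) (F : seq bool -> X) :=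
  forall p q, size p + m.+1 + size q = n ->
    F (p ++ a ++ q) = F (p ++ map negb a ++ q).

Lemma map_negbK (w : seq bool) : map negb (map negb w) = w.
Proof. exact: (mapK negbK). Qed.

Lemma val_simple_map n (i : 'I_n) (u : n.-tuple bool) p w q :
  val u = p ++ w ++ q -> size p = i -> size w = m.+1 ->
  w \in [:: val a; map negb a] ->
  val (simple_map a i u) = p ++ map negb w ++ q.
Proof.
move=> ue pi wm wa.
have sz : size (p ++ w ++ q) = n by rewrite -ue size_tuple.
have c : (i + m < n) && (take m.+1 (drop i u) \in [:: val a; val (negw a)]).
  rewrite [tval u]ue -pi drop_size_cat // (take_size_cat _ wm) wa andbT.
  by move: sz; rewrite !size_cat; lia.
apply: (@eq_from_nth _ false) => [|j].
  by rewrite size_tuple -sz !size_cat size_map.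
rewrite size_tuple => jn.
rewrite -[LHS](tnth_nth false (simple_map a i u) (Ordinal jn)) tnth_simple_map //.
rewrite (tnth_nth false) [tval u]ue /= !nth_cat size_map pi wm.
case: (ltnP j i) => //= ij.
have -> : (j <= i + m) = (j - i < m.+1) by lia.
case: ltnP => //= jm.
by rewrite (nth_map false) ?wm //; case: nth.
Qed.

Lemma sim_invariant n (X : Type) (F : seq bool -> X) (u v : n.-tuple bool) :
  invariant n F -> sim a u v -> F u = F v.
Proof.
move=> inv /simP[s <-]; elim: s u => //= i s IH u; rewrite -IH.
case c : ((i + m < n) && (take m.+1 (drop i u) \in [:: val a; val (negw a)]));
  last by rewrite /simple_map c.
have [im wa] := andP c.
pose p := take i u; pose w := take m.+1 (drop i u); pose q := drop m.+1 (drop i u).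
have ue : val u = p ++ w ++ q by rewrite !cat_take_drop.
have pi : size p = i by rewrite size_takel // size_tuple ltnW.
have wm : size w = m.+1.
  by rewrite size_takel // size_drop size_tuple; lia.
have sz : size p + m.+1 + size q = n.
  by rewrite -wm -addnA -!size_cat -ue size_tuple.
have se := val_simple_map ue pi wm wa.
rewrite [tval (simple_map _ _ _)]se [tval u]ue.
move: wa; rewrite -/w !inE => /orP[]/eqP ->; first exact: inv.
by rewrite map_negbK; apply/esym; exact: inv.
Qed.

(** A class is encoded by its canonical representative, recovered by [val]. *)
Definition cls n := {u : n.-tuple bool | roots (step a) u}.

Definition class_of n (u : n.-tuple bool) : cls n :=
  exist _ (fingraph.root (step a) u) (roots_root (@step_connect_sym n) u).

Lemma class_of_eq n (u v : n.-tuple bool) : (class_of u == class_of v) = sim a u v.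
Proof. exact: root_connect (@step_connect_sym n) u v. Qed.

Lemma class_of_val n (c : cls n) : class_of (val c) = c.
Proof. by apply: val_inj; apply/eqP; exact: (valP c). Qed.

(* Words of length other than n get the junk class of the all-[false] word. *)
Definition wclass n (s : seq bool) : cls n :=
  class_of (insubd (nseq_tuple n false) s).

Lemma wclass_tuple n (u : n.-tuple bool) : wclass n u = class_of u.
Proof. by rewrite /wclass valKd. Qed.

Lemma wclassE n s (sn : size s == n) : wclass n s = class_of (Tuple sn).
Proof. exact: (wclass_tuple (Tuple sn)). Qed.

Lemma wclass_invariant n : invariant n (wclass n).
Proof.
move=> p q pq.
have s1 : size (p ++ a ++ q) == n by rewrite !size_cat size_tuple addnA pq.
have s2 : size (p ++ map negb a ++ q) == n.
  by rewrite !size_cat size_map size_tuple addnA pq.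
rewrite (wclassE s1) (wclassE s2); apply/eqP; rewrite class_of_eq.
have pn : size p < n by lia.
apply: connect1; apply/existsP; exists (Ordinal pn); apply/eqP/val_inj.
by rewrite (@val_simple_map _ _ _ p a q) ?size_tuple ?inE ?eqxx.
Qed.

Lemma wclass_cat n k p s t : size s = k -> size t = k -> size p + k = n ->
  wclass k s = wclass k t -> wclass n (p ++ s) = wclass n (p ++ t).
Proof.
move=> /eqP sk /eqP tk pk; rewrite (wclassE sk) (wclassE tk).
move/eqP; rewrite class_of_eq.
(* An occurrence of the keyword in [s] is also one in [p ++ s], so this map is invariant. *)
apply: (sim_invariant (F := fun s => wclass n (p ++ s)) (u := Tuple sk) (v := Tuple tk)).
by move=> p' q pq; rewrite !(catA p); apply: wclass_invariant; rewrite size_cat; lia.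
Qed.

Lemma card_cls_partition n :
  #|equivalence_partition (sim a) [set: n.-tuple bool]| = #|{: cls n}|.
Proof.
rewrite card_sig.
pose f (u : n.-tuple bool) := [set v in [set: n.-tuple bool] | sim a u v].
have -> : equivalence_partition (sim a) [set: n.-tuple bool]
    = [set f u | u in [pred u | roots (step a) u]].
  apply/setP => B; apply/imsetP/imsetP => -[u _ ->]; last by exists u.
  exists (fingraph.root (step a) u); first exact: (roots_root (@step_connect_sym n)).
  apply/setP => v; rewrite !inE; apply: (sim_equiv a u _ v).2.
  exact: connect_root.
apply: card_in_imset => u v /eqP ru /eqP rv /setP/(_ v).
rewrite !inE /sim connect0 -(root_connect (@step_connect_sym n)) ru rv.
by move/eqP.
Qed.

(** [E] meets every class of possible continuations [q] of a keyword at the start of a word of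
    length [n.+1]; each of its members costs one edge in [card_le_collapse]. *)
Lemma card_cls_lower n (E : seq (seq bool)) :
  (forall q, size q + m = n ->
     exists2 q', q' \in E & size q' = size q /\ wclass (size q) q = wclass (size q) q') ->
  2 * #|{: cls n}| <= #|{: cls n.+1}| + size E.
Proof.
move=> EP; rewrite mulnC -card_bool -card_prod.
pose na : seq bool := map negb a.
pose edge q := ((wclass n (behead a ++ q), head false a),
                (wclass n (behead na ++ q), head false na)).
rewrite -(size_map edge).
apply: (card_le_collapse (h := fun cb : cls n * bool => wclass n.+1 (cb.2 :: val (val cb.1)))).
move=> f fE [c b] [d b'] /=.
pose F s := if s is b :: u then f (wclass n u, b) else 0%R.
(* An occurrence after the first letter does not change the class of the tail. One at the start is
   moved to an edge of [E] by replacing [q] with an equivalent [q']. *)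
have invF : invariant n.+1 F.
  move=> [|b0 p] q /= pq; last first.
    by congr f; congr pair; apply: wclass_invariant; lia.
  have [q' q'E [sq' qq']] : exists2 q', q' \in E & size q' = size q
       /\ wclass (size q) q = wclass (size q) q' by apply: EP; lia.
  have := fE (edge q') (map_f edge q'E); rewrite /edge /na /F /=.
  case: {qq' pq fE} (a : seq bool) (size_tuple a) qq' pq => //= a0 a' [sa'] qq' pq.
  rewrite -!(@wclass_cat n (size q) _ q q') ?size_map //; lia.
have sz (c0 : cls n) b0 : size (b0 :: val (val c0)) == n.+1 by rewrite /= size_tuple.
rewrite (wclassE (sz c b)) (wclassE (sz d b')) => /eqP; rewrite class_of_eq.
by move/(sim_invariant invF); rewrite /F /= !wclass_tuple !class_of_val.
Qed.

(** * Upper bound through the transform *)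

Section Upper.
Local Open Scope ring_scope.

(* Rewriting y x^m to the other odd words increases [binval], which is at most 2^n. *)
Lemma hat_determined n (F : seq bool -> rat) : invariant n F ->
  (forall w, w \in avoiders m n -> hat F w = 0) ->
  forall w, size w = n -> hat F w = 0.
Proof.
move=> inv F0 w wn.
have [k] := ubnP (2 ^ n - binval w)%N; elim: k w wn => // k IH w wn wk.
have [gw|/avoidsPn[p [q we]]] := boolP (avoids m w).
  by apply: F0; rewrite mem_filter gw -wn mem_words.
(* Only the letters outside the window are transformed, so invariance of [F] gives [G] equal values
   at [a] and its negation. *)
pose G v := hat (fun p' => hat (fun q' => F (p' ++ v ++ q')) q) p.
have hatG v : hat G v = hat F (p ++ v ++ q).
  rewrite /G (hat_exchange (fun v p' => hat (fun q' => F (p' ++ v ++ q')) q)).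
  rewrite hat_cat; apply: eq_hat => p' _.
  by rewrite (hat_cat (fun u => F (p' ++ u))).
rewrite we -hatG.
have sz : (size p + m.+1 + size q)%N = n.
  by rewrite -wn we !size_cat /= size_nseq addnA.
apply: (hat_odd_last (a := a)).
- by rewrite /= size_nseq size_tuple.
- by rewrite /= count_nseq mul0n.
- apply: eq_hat => p' sp; apply: eq_hat => q' sq.
  by apply: inv; rewrite sp sq.
move=> v; rewrite size_tuple => sv ov /(binval_gt1 sv ov) v1; rewrite hatG.
have svn : size (p ++ v ++ q) = n by rewrite !size_cat sv addnA.
apply: IH => //; have := binval_lt (p ++ v ++ q); rewrite svn.
suff : (binval w < binval (p ++ v ++ q))%N by lia.
rewrite we !binval_cat ltn_add2l ltn_pmul2l ?expn_gt0 //= sv size_nseq ltn_add2r.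
suff -> : binval (nseq m false) = 0%N by [].
by elim: (m) => //= m' ->.
Qed.

(** The transforms of the class indicators, evaluated at the avoiding words, have independent rows:
    a combination vanishing there has zero transform, hence is zero. *)
Lemma card_cls_upper n : (#|{: cls n}| <= size (avoiders m n))%N.
Proof.
apply: (card_le_separating (w0 := [::])
  (M := fun (c : cls n) w => hat (fun u => (wclass n u == c)%:R) w)).
move=> f f0 c.
pose F u := f (wclass n u).
have hF w : hat F w = \sum_c f c * hat (fun u => (wclass n u == c)%:R) w.
  under eq_bigr => d _ do rewrite -hatZ.
  rewrite -hat_sum; apply: eq_hat => u _.
  rewrite (bigD1 (wclass n u)) //= eqxx mulr1 big1 ?addr0 // => d.
  by rewrite eq_sym => /negbTE ->; rewrite mulr0.
suff : F (val (val c)) = 0 by rewrite /F wclass_tuple class_of_val.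
apply: (@hat_inj0 F n); last exact: size_tuple.
apply: hat_determined => [p q pq|w wL].
  by congr f; exact: wclass_invariant.
by rewrite hF -(nth_index [::] wL); apply: f0; rewrite index_mem.
Qed.

End Upper.

Lemma card_cls n : #|{: cls n}| = size (avoiders m n).
Proof.
elim/ltn_ind: n => n IH; apply/eqP; rewrite eqn_leq card_cls_upper /=.
case: n IH => [|n] IH; first by apply/card_gt0P; exists (wclass 0 [::]).
have := size_avoidersS m n; rewrite -(IH n) //.
case: leqP => mn e.
  (* One representative of each class of length [n - m] suffices. *)
  have := @card_cls_lower n [seq val (val c) | c <- enum {: cls (n - m)}] _.
  rewrite size_map -cardE (IH (n - m)); last by lia.
  rewrite -e leq_add2r; apply => q qm.
  have sq : size q = n - m by lia.
  exists (val (val (wclass (n - m) q))).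
    by apply: (map_f (fun c : cls (n - m) => val (val c))); rewrite mem_enum.
  by rewrite size_tuple sq wclass_tuple class_of_val.
(* Words of length [n.+1 <= m] are too short to contain the keyword. *)
have := @card_cls_lower n [::] _; rewrite addn0 -e addn0; apply => q qm.
by exfalso; lia.
Qed.

End Classes.

Theorem theorem1p1 (n m : nat) (hn : 0 < n) (hm : 0 < m) (a : m.+1.-tuple bool) :
  #|equivalence_partition (sim a) [set: n.-tuple bool]| =
    \sum_(0 <= k < n.+1) mfib m k.
Proof. by rewrite card_cls_partition card_cls size_avoiders. Qed.
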